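(* Let $\sigma$ be a non-negative measure on the Borel subsets of $\mathbb{R}$ with all finite power moments, $\int_{\mathbb{R}}d\sigma=1$, and $\int_{\mathbb{R}}|g(x)|^2d\sigma>0$ for every non-zero complex polynomial $g$. Let $c>-1$ and $d\in\mathbb{R}$ with $c\neq0$ and $d\neq0$, and let $\mathcal{A}$ be the linear operator in $L^2_\sigma$ with domain $\mathcal{P}$ given by $$\mathcal{A}[p(\lambda)]=[\lambda p(\lambda)+p(0)(c\lambda+d)]$$ for every complex polynomial $p$. Then for an arbitrary positive integer $N$ the operator $\mathcal{A}^N$ is not symmetric.
   Context: $\mathcal{P}\subset L^2_\sigma$ denotes the set of all classes $[p]$ of complex polynomials $p$ in $L^2_\sigma$ (by the assumption on $\sigma$, distinct polynomials give distinct classes). A linear operator $B$ with domain $\mathcal{P}$ is symmetric if $(Bf,g)_{L^2_\sigma}=(f,Bg)_{L^2_\sigma}$ for all $f,g\in\mathcal{P}$. *)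

(* Defs.v *)
From HB Require Import structures.
From mathcomp Require Import all_boot all_order all_algebra.
From mathcomp Require Import all_classical all_reals all_analysis.
From mathcomp Require Import measurable_realfun complex ring.

Set Implicit Arguments.
Unset Strict Implicit.
Unset Printing Implicit Defensive.

Import Order.TTheory GRing.Theory Num.Theory.
Import numFieldNormedType.Exports.

Local Open Scope classical_set_scope.
Local Open Scope ring_scope.
Local Open Scope complex_scope.
Local Open Scope quotient_scope.

Notation cabs := Normc.normc.

Section SquareIntegrable.
Context d (T : measurableType d) (R : realType).
Variable mu : {measure set T -> \bar R}.
Local Notation C := R[i].

(* Measurability of a complex-valued function is that of its two parts. *)
Definition square_integrable (f : T -> C) : Prop :=
  [/\ measurable_fun [set: T] (fun x => complex.Re (f x)),
      measurable_fun [set: T] (fun x => complex.Im (f x)) &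
      (\int[mu]_x (cabs (f x) ^+ 2)%:E < +oo)%E].

Lemma cabs2E (z : C) :
  cabs z ^+ 2 = (complex.Re z) ^+ 2 + (complex.Im z) ^+ 2.
Proof. by case: z => a b /=; rewrite sqr_sqrtr// addr_ge0// sqr_ge0. Qed.

Lemma measurable_cabs2 (f : T -> C) :
  measurable_fun [set: T] (fun x => complex.Re (f x)) ->
  measurable_fun [set: T] (fun x => complex.Im (f x)) ->
  measurable_fun [set: T] (fun x => (cabs (f x) ^+ 2)%:E).
Proof.
move=> mr mi; apply/measurable_EFinP.
under eq_fun do rewrite cabs2E.
by apply: measurable_funD; apply: measurable_funX.
Qed.

Definition L2_pred : {pred T -> C} := fun f => `[< square_integrable f >].

Lemma square_integrableP (f : T -> C) :
  reflect (square_integrable f) (f \in L2_pred).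
Proof. exact: asboolP. Qed.

Lemma cabs2D_le (z w : C) :
  cabs (z + w) ^+ 2 <= 2 * cabs z ^+ 2 + 2 * cabs w ^+ 2.
Proof.
rewrite !cabs2E; case: z w => [a b] [e f] /=.
rewrite -subr_ge0.
rewrite (_ : _ - _ = (a - e) ^+ 2 + (b - f) ^+ 2).
  by rewrite addr_ge0// sqr_ge0.
by rewrite !expr2 !mulr_natl !mulr2n !(mulrDl, mulrDr, mulrN, mulNr) !opprK
  ?opprD; ring.
Qed.

Lemma L2_submod_closed : submod_closed L2_pred.
Proof.
split.
  apply/square_integrableP; split => /=.
  - exact: measurable_cst.
  - exact: measurable_cst.
  - under eq_integral do rewrite !expr0n/= addr0 sqrtr0 expr0n/=.
    by rewrite integral0.
move=> a f g /square_integrableP[fr fi fI] /square_integrableP[gr gi gI].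
have hr x : complex.Re ((a *: f + g) x) =
    complex.Re a * complex.Re (f x) - complex.Im a * complex.Im (f x)
    + complex.Re (g x).
  rewrite [in LHS]/GRing.add /= [in LHS]/GRing.scale /=.
  by move: (f x) (g x) => [? ?] [? ?]; case: (a) => ? ?.
have hi x : complex.Im ((a *: f + g) x) =
    complex.Re a * complex.Im (f x) + complex.Im a * complex.Re (f x)
    + complex.Im (g x).
  rewrite [in LHS]/GRing.add /= [in LHS]/GRing.scale /=.
  by move: (f x) (g x) => [? ?] [? ?]; case: (a) => ? ?.
have mr : measurable_fun [set: T] (fun x => complex.Re ((a *: f + g) x)).
  under eq_fun do rewrite hr.
  apply: measurable_funD => //; apply: measurable_funB;
  by apply: measurable_funM.
have mi : measurable_fun [set: T] (fun x => complex.Im ((a *: f + g) x)).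
  under eq_fun do rewrite hi.
  by apply: measurable_funD => //; apply: measurable_funD;
  apply: measurable_funM.
apply/square_integrableP; split => //.
have mf := measurable_cabs2 fr fi.
have mg := measurable_cabs2 gr gi.
pose k := 2 * cabs a ^+ 2.
apply: (@le_lt_trans _ _
  (\int[mu]_x (k%:E * (cabs (f x) ^+ 2)%:E + 2%:E * (cabs (g x) ^+ 2)%:E))%E).
  apply: ge0_le_integral => //.
  - by move=> x _; rewrite lee_fin sqr_ge0.
  - exact: measurable_cabs2.
  - by apply: emeasurable_funD; apply: emeasurable_funM.
  - move=> x _; rewrite lee_fin (le_trans (cabs2D_le _ _))//.
    by rewrite lerD2r /k -mulrA -exprMn -Normc.normcM.
have k0 : 0 <= k by rewrite mulr_ge0// sqr_ge0.
rewrite ge0_integralD//; last 4 first.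
- by move=> x _; rewrite lee_fin mulr_ge0// sqr_ge0.
- exact: emeasurable_funM.
- by move=> x _; rewrite lee_fin mulr_ge0// sqr_ge0.
- exact: emeasurable_funM.
rewrite !ge0_integralZl_EFin//; try by move=> x _; rewrite lee_fin sqr_ge0.
by rewrite lte_add_pinfty// lte_mul_pinfty// lee_fin.
Qed.

HB.instance Definition _ :=
  GRing.isSubmodClosed.Build C (T -> C) L2_pred L2_submod_closed.

End SquareIntegrable.

Section L2Fun.
Context d (T : measurableType d) (R : realType).
Variable mu : {measure set T -> \bar R}.
Local Notation C := R[i].

Record L2fun := MkL2fun { L2val :> T -> C ; _ : L2val \in L2_pred mu }.

HB.instance Definition _ := [isSub for L2val].
HB.instance Definition _ := [Choice of L2fun by <:].
HB.instance Definition _ := [SubChoice_isSubLmodule of L2fun by <:].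

Definition ae_zero : {pred L2fun} :=
  fun f => `[< \forall x \ae mu, f x = 0 >].

Lemma ae_zeroP (f : L2fun) :
  reflect (\forall x \ae mu, f x = 0) (f \in ae_zero).
Proof. exact: asboolP. Qed.

Lemma ae_zero_submod_closed : submod_closed ae_zero.
Proof.
split; first by apply/ae_zeroP; apply: nearW.
move=> a f g /ae_zeroP f0 /ae_zeroP g0; apply/ae_zeroP.
apply: filterS2 f0 g0 => x f0 g0.
change (a * f x + g x = 0).
by rewrite f0 g0 mulr0 addr0.
Qed.

HB.instance Definition _ :=
  GRing.isSubmodClosed.Build C L2fun ae_zero ae_zero_submod_closed.

(* The Hilbert space L^2 of complex-valued functions: square-integrable
   functions modulo those vanishing almost everywhere. *)
Definition L2 : Type := Quotient.quot ae_zero.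
HB.instance Definition _ := GRing.Zmodule.on L2.
HB.instance Definition _ : EqQuotient L2fun (Quotient.equiv ae_zero) L2 :=
  EqQuotient.on L2.

Definition L2class (f : L2fun) : L2 := \pi_L2 f.

Lemma L2classP (f g : L2fun) :
  L2class f = L2class g <-> \forall x \ae mu, f x = g x.
Proof.
split=> [/eqP|fg].
  rewrite -[_ == _]/(f == g %[mod L2]) eqmodE /= => /ae_zeroP.
  by apply: filterS => x /eqP; rewrite subr_eq0 => /eqP.
apply/eqP; rewrite -[_ == _]/(f == g %[mod L2]) eqmodE /=.
apply/ae_zeroP; apply: filterS fg => x fgx.
by apply/eqP; rewrite subr_eq0; apply/eqP.
Qed.

Lemma L2classK (u : L2) : L2class (repr u) = u.
Proof. exact: reprK. Qed.

Lemma repr_L2class (f : L2fun) :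
  \forall x \ae mu, (repr (L2class f) : L2fun) x = f x.
Proof. by apply/L2classP; rewrite L2classK. Qed.

Lemma L2classD (f g : L2fun) : L2class (f + g) = L2class f + L2class g.
Proof. exact: (raddfD (\pi_(Quotient.quot ae_zero))). Qed.

Definition L2scale (a : C) (u : L2) : L2 := L2class (a *: repr u).

Lemma L2scale_class a f : L2scale a (L2class f) = L2class (a *: f).
Proof.
apply/L2classP; apply: filterS (repr_L2class f) => x e.
by change (a * (repr (L2class f) : L2fun) x = a * f x); rewrite e.
Qed.

Lemma L2scaleA a b u : L2scale a (L2scale b u) = L2scale (a * b) u.
Proof. by rewrite -[u]L2classK !L2scale_class scalerA. Qed.

Lemma L2scale1 : left_id 1 L2scale.
Proof. by move=> u; rewrite -[u]L2classK L2scale_class scale1r. Qed.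

Lemma L2scaleDr : right_distributive L2scale +%R.
Proof.
move=> a u v; rewrite -[u]L2classK -[v]L2classK.
by rewrite -L2classD !L2scale_class scalerDr L2classD.
Qed.

Lemma L2scaleDl v : {morph L2scale^~ v : a b / a + b}.
Proof.
by move=> a b; rewrite -[v]L2classK !L2scale_class scalerDl L2classD.
Qed.

HB.instance Definition _ := GRing.Zmodule_isLmodule.Build C L2
  L2scaleA L2scale1 L2scaleDr L2scaleDl.

Lemma L2classZ a f : L2class (a *: f) = a *: L2class f.
Proof. by rewrite [RHS]L2scale_class. Qed.

Definition cintegral (f : T -> C) : C :=
  (\int[mu]_x complex.Re (f x)) +i* (\int[mu]_x complex.Im (f x)).

Definition L2fun_dot (f g : T -> C) : C := cintegral (fun x => f x * (g x)^*).

Definition L2dot (u v : L2) : C := L2fun_dot (repr u : L2fun) (repr v : L2fun).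

Lemma L2dot_class (f g : L2fun) :
  L2dot (L2class f) (L2class g) = L2fun_dot f g.
Proof.
have [ff gg] := (repr_L2class f, repr_L2class g).
have Lr (h : L2fun) : measurable_fun [set: T] (fun x => complex.Re (h x)).
  by case: h => h /= /square_integrableP[].
have Li (h : L2fun) : measurable_fun [set: T] (fun x => complex.Im (h x)).
  by case: h => h /= /square_integrableP[].
have er (h k : L2fun) : (fun x => complex.Re (h x * (k x)^*)) =
    (fun x => complex.Re (h x) * complex.Re (k x)
      + complex.Im (h x) * complex.Im (k x)).
  by apply/funext => x; case: (h x) (k x) => [? ?] [? ?] /=; ring.
have ei (h k : L2fun) : (fun x => complex.Im (h x * (k x)^*)) =
    (fun x => complex.Im (h x) * complex.Re (k x)
      - complex.Re (h x) * complex.Im (k x)).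
  by apply/funext => x; case: (h x) (k x) => [? ?] [? ?] /=; ring.
have mr (h k : L2fun) :
    measurable_fun [set: T] (fun x => complex.Re (h x * (k x)^*)).
  by rewrite er; apply: measurable_funD; apply: measurable_funM.
have mi (h k : L2fun) :
    measurable_fun [set: T] (fun x => complex.Im (h x * (k x)^*)).
  by rewrite ei; apply: measurable_funB; apply: measurable_funM.
rewrite /L2dot /L2fun_dot /cintegral /Rintegral.
congr (fine _ +i* fine _); apply: ae_eq_integral => //;
  try (by apply/measurable_EFinP);
  by apply: filterS2 ff gg => x -> ->.
Qed.

End L2Fun.

(* A linear operator in V whose domain is a linear subspace of V; the values of
   the underlying map outside the domain are irrelevant. *)
Record lin_operator (K : pzRingType) (V : lmodType K) := LinOperator {
  dom : set V ;
  opmap :> V -> V ;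
  dom0 : dom 0 ;
  dom_lin : forall a u v, dom u -> dom v -> dom (a *: u + v) ;
  op_lin : forall a u v, dom u -> dom v ->
    opmap (a *: u + v) = a *: opmap u + opmap v }.

Section Operators.
Context (K : pzRingType) (V : lmodType K).

Lemma op_dom0 (A : lin_operator V) : A 0 = 0.
Proof.
have := op_lin (-1) (dom0 A) (dom0 A).
by rewrite scaler0 addr0 scaleN1r addNr.
Qed.

Definition op_id : lin_operator V :=
  @LinOperator K V [set: V] id I (fun _ _ _ _ _ => I) (fun _ _ _ _ _ => erefl).

Section Composition.
Variables A B : lin_operator V.

Definition op_comp_dom : set V := [set u | dom B u /\ dom A (B u)].

Lemma op_comp_dom0 : op_comp_dom 0.
Proof. by split; [|rewrite op_dom0]; exact: dom0. Qed.

Lemma op_comp_dom_lin a u v :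
  op_comp_dom u -> op_comp_dom v -> op_comp_dom (a *: u + v).
Proof.
move=> [Bu ABu] [Bv ABv]; split; first exact: dom_lin.
by rewrite op_lin//; exact: dom_lin.
Qed.

Lemma op_comp_lin a u v : op_comp_dom u -> op_comp_dom v ->
  A (B (a *: u + v)) = a *: A (B u) + A (B v).
Proof. by move=> [? ?] [? ?]; rewrite !op_lin. Qed.

Definition op_comp : lin_operator V :=
  LinOperator op_comp_dom0 op_comp_dom_lin op_comp_lin.

End Composition.

(* Power of a partially defined operator, with its natural domain. *)
Definition op_pow (A : lin_operator V) (n : nat) : lin_operator V :=
  iter n (op_comp A) op_id.

Lemma dom_op_pow (A : lin_operator V) (n : nat) :
  (forall u, dom A u -> dom A (A u)) -> dom (op_pow A n.+1) = dom A.
Proof.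
move=> stab.
have it m u : dom A u -> dom (op_pow A m) u /\ dom A (op_pow A m u).
  by elim: m => //= m IH /IH[? ?]; split; [split|exact: stab].
apply/seteqP; split=> u; last by move=> /(it n.+1)[].
by elim: n => [[]//|n IH [/IH]].
Qed.

End Operators.

Definition symmetric_op d (T : measurableType d) (R : realType)
    (mu : {measure set T -> \bar R}) (B : lin_operator (L2 mu)) : Prop :=
  forall f g, dom B f -> dom B g -> L2dot (B f) g = L2dot f (B g).

Section Polynomials.
Context (R : realType).
Local Notation C := R[i].
Variable sigma : {measure set (measurableTypeR R) -> \bar R}.

Definition finite_moments : Prop :=
  forall n, sigma.-integrable [set: R] (fun x : R => (x ^+ n)%:E).

Lemma polyL2_subproof (hm : finite_moments) (p : {poly C}) :
  (fun x : R => p.[x%:C]) \in L2_pred sigma.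
Proof.
rewrite (_ : (fun x : R => _) =
    \sum_(i < size p) p`_i *: (fun x : R => x%:C ^+ i)); last first.
  by apply/funext => x; rewrite horner_coef fct_sumE.
apply: rpred_sum => i _; apply: rpredZ; apply/square_integrableP.
have e (x : R) : x%:C ^+ i = (x ^+ i)%:C by rewrite -rmorphXn.
under eq_fun do rewrite e.
split; [exact: exprn_measurable | exact: measurable_cst |].
under eq_integral do rewrite cabs2E /= expr0n /= addr0 -exprM.
have /integrableP[_] := hm (i * 2)%N.
apply: le_lt_trans; apply: ge0_le_integral => //.
- by move=> x _; rewrite lee_fin mulnC exprM exprn_ge0// sqr_ge0.
- apply/measurable_EFinP; exact: exprn_measurable.
- apply: measurableT_comp => //.
  apply/measurable_EFinP; exact: exprn_measurable.
- by move=> x _; rewrite /= lee_fin ler_norm.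
Qed.

(* The class [p] in L^2 of a complex polynomial p, as a function of a real
   variable. *)
Definition polyL2 (hm : finite_moments) (p : {poly C}) : L2 sigma :=
  L2class (MkL2fun (polyL2_subproof hm p)).

Lemma polyL2_lin (hm : finite_moments) a (p q : {poly C}) :
  polyL2 hm (a *: p + q) = a *: polyL2 hm p + polyL2 hm q.
Proof.
rewrite -L2classZ -L2classD; congr L2class; apply/val_inj/funext => x.
by rewrite /= hornerD hornerZ.
Qed.

Definition positive_on_polys : Prop := forall g : {poly C}, g != 0 ->
  (0 < \int[sigma]_x (cabs g.[x%:C] ^+ 2)%:E)%E.

Lemma polyL2_inj (hm : finite_moments) :
  positive_on_polys -> injective (polyL2 hm).
Proof.
move=> hpos p q /L2classP pq; apply/eqP; rewrite -subr_eq0.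
apply/negPn/negP => /hpos; apply/negP; rewrite -leNgt.
have /square_integrableP[mr mi _] := polyL2_subproof hm (p - q).
rewrite (@ae_eq_integral _ _ _ _ _ (cst 0%E)) ?integral0//.
  exact: measurable_cabs2.
apply: filterS pq => x /= e _.
by rewrite hornerD hornerN e subrr cabs2E /= expr0n /= addr0.
Qed.

(* Since distinct polynomials have distinct classes, every linear map on
   polynomials induces an operator in L^2 with domain the classes of
   polynomials. *)
Lemma exists_poly_operator (hm : finite_moments) (hp : positive_on_polys)
    (L : {linear {poly C} -> {poly C}}) :
  exists A : lin_operator (L2 sigma), dom A = range (polyL2 hm) /\
    forall p, A (polyL2 hm p) = polyL2 hm (L p).
Proof.
pose S := polyL2 hm.
pose F u := S (L (xget 0 [set p | S p = u])).
have FS p : F (S p) = S (L p).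
  by rewrite /F; case: xgetP => [q _ /(polyL2_inj hp) ->//|/(_ p)]; case.
have S0 : range S 0.
  exists 0 => //; have := polyL2_lin hm (-1) 0 0.
  by rewrite scaler0 addr0 scaleN1r addNr.
have Sl a u v : range S u -> range S v -> range S (a *: u + v).
  by move=> [p _ <-] [q _ <-]; exists (a *: p + q) => //; exact: polyL2_lin.
have Fl a u v : range S u -> range S v -> F (a *: u + v) = a *: F u + F v.
  by move=> [p _ <-] [q _ <-]; rewrite -polyL2_lin !FS linearP -polyL2_lin.
by exists (LinOperator S0 Sl Fl).
Qed.

End Polynomials.

(* Main.v *)
Require Import Defs.
From mathcomp Require Import all_boot all_order all_algebra.
From mathcomp Require Import all_classical all_reals all_analysis.
From mathcomp Require Import measurable_realfun complex ring.

Import Order.TTheory GRing.Theory Num.Theory.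
Import numFieldNormedType.Exports.

Local Open Scope classical_set_scope.
Local Open Scope ring_scope.
Local Open Scope complex_scope.

(** Put [L p = X p + p(0)(c X + d)] and [w = L^N 1 - X^N]. On polynomials
    vanishing at [0], [L^N] is multiplication by [x^N], so symmetry tested
    against [1] and [x^2 w] forces [(w, x^2 w) = 0], that is [x w = 0] by
    positivity. But [(L p)(0) = d p(0)], so [w(0) = d^N] is not zero. *)

(** At a real point the powers of [x] are real, so taking real parts acts on the coefficients alone
    and leaves a finite real combination of integrable powers. *)
Lemma integrable_Re_poly (R : realType)
    (sigma : {measure set (measurableTypeR R) -> \bar R})
    (hmom : finite_moments sigma) (p : {poly R[i]}) :
  sigma.-integrable [set: R] (fun x : R => (complex.Re p.[x%:C])%:E).
Proof.
have -> : (fun x : R => (complex.Re p.[x%:C])%:E) =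
    (fun x : R => \sum_(i < size p) (complex.Re p`_i)%:E * (x ^+ i)%:E)%E.
  apply/funext => x; rewrite horner_coef raddf_sum /= -sumEFin.
  apply: eq_bigr => i _; rewrite -rmorphXn /=.
  by case: (p`_i) => a b /=; rewrite mulr0 subr0 EFinM.
apply: integrable_sum => // i _.
exact/integrableZl/hmom.
Qed.

Lemma integrable_cabs2_poly (R : realType)
    (sigma : {measure set (measurableTypeR R) -> \bar R})
    (hmom : finite_moments sigma) (p : {poly R[i]}) :
  sigma.-integrable [set: R] (fun x : R => (cabs p.[x%:C] ^+ 2)%:E).
Proof.
have /square_integrableP[mr mi fin] := polyL2_subproof hmom p.
apply/integrableP; split; first exact: measurable_cabs2.
by under eq_integral do rewrite gee0_abs ?lee_fin ?sqr_ge0//.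
Qed.

Lemma Re_polyL2_dot (R : realType)
    (sigma : {measure set (measurableTypeR R) -> \bar R})
    (hmom : finite_moments sigma) (p q : {poly R[i]}) :
  complex.Re (L2dot (polyL2 hmom p) (polyL2 hmom q)) =
  \int[sigma]_x complex.Re (p.[x%:C] * q.[x%:C]^*).
Proof. by rewrite L2dot_class. Qed.

(** The map [L], with a general polynomial [h] in place of [c X + d]. *)
Definition mulX_perturb {R : comNzRingType} (h p : {poly R}) : {poly R} :=
  'X * p + p.[0] *: h.

(** Multiplication by ['X] preserves the root at 0, so the perturbing term vanishes at every
    iteration. *)
Lemma iter_mulX_perturb_root0 (R : comNzRingType) (h p : {poly R}) (n : nat) :
  p.[0] = 0 -> iter n (mulX_perturb h) p = 'X^n * p.
Proof.
move=> p0; elim: n => [|n IH]; first by rewrite expr0 mul1r.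
by rewrite iterS IH /mulX_perturb hornerM p0 mulr0 scale0r addr0 mulrA -exprS.
Qed.

(** The summand ['X * p] vanishes at 0, so only the multiple of [h] contributes there. *)
Lemma horner0_iter_mulX_perturb (R : comNzRingType) (h p : {poly R}) (n : nat) :
  (iter n (mulX_perturb h) p).[0] = h.[0] ^+ n * p.[0].
Proof.
elim: n => [|n IH]; first by rewrite expr0 mul1r.
rewrite iterS /mulX_perturb hornerD hornerM hornerX mul0r add0r hornerZ IH.
by rewrite mulrC exprS mulrA.
Qed.

Lemma op_pow_polyL2 (R : realType)
    (sigma : {measure set (measurableTypeR R) -> \bar R})
    (hmom : finite_moments sigma) (A : lin_operator (L2 sigma))
    (L : {poly R[i]} -> {poly R[i]}) :
  (forall p, A (polyL2 hmom p) = polyL2 hmom (L p)) ->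
  forall n p, op_pow A n (polyL2 hmom p) = polyL2 hmom (iter n L p).
Proof. by move=> hA; elim=> [//|n IH] p /=; rewrite IH hA. Qed.

Theorem mainTheorem8 (R : realType)
  (sigma : {measure set (measurableTypeR R) -> \bar R})
  (hmom : finite_moments sigma)
  (hmass : (\int[sigma]_x 1 = 1)%E)
  (hpos : positive_on_polys sigma)
  (c d : R) (hc : -1 < c) (hc0 : c != 0) (hd0 : d != 0)
  (A : lin_operator (L2 sigma))
  (hdom : dom A = range (polyL2 hmom))
  (hA : forall p : {poly R[i]},
    A (polyL2 hmom p) =
    polyL2 hmom ('X * p + p.[0] *: (c%:C *: 'X + d%:C%:P)))
  (N : nat) (hN : (0 < N)%N) :
  ~ symmetric_op (op_pow A N).
Proof.
(* The successor form matters: the zeroth power has the whole space as domain, and [w.[0]] is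
   computed with [0 ^+ N.+1 = 0]. *)
case: N hN => [//|N] _.
set h : {poly R[i]} := c%:C *: 'X + d%:C%:P.
have hL p : A (polyL2 hmom p) = polyL2 hmom (mulX_perturb h p) := hA p.
have domN p : dom (op_pow A N.+1) (polyL2 hmom p).
  rewrite dom_op_pow hdom; first by exists p.
  by move=> _ [q _ <-]; rewrite hL; exists (mulX_perturb h q).
set w := iter N.+1 (mulX_perturb h) 1 - 'X^(N.+1).
have w0 : w.[0] != 0.
  rewrite hornerD hornerN horner0_iter_mulX_perturb hornerXn expr0n /= subr0.
  rewrite -polyC1 hornerC mulr1 expf_neq0// /h !hornerE.
  by apply: contra hd0 => /eqP[->].
(* Real parts suffice, since the quantity to isolate, the integral of |x w|^2, is real. *)
move=> /(_ _ _ (domN 1) (domN ('X * ('X * w)))) /(congr1 (@complex.Re R)).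
rewrite !(op_pow_polyL2 _ _ _ _ _ hL).
rewrite [in RHS]iter_mulX_perturb_root0; last by rewrite hornerM hornerX mul0r.
rewrite (_ : iter _ _ 1 = 'X^(N.+1) + w); last by rewrite addrC subrK.
clearbody w.
set q := 'X^(N.+1) * _.
rewrite !Re_polyL2_dot.
(* As [x] is real, [w] paired with [x^2 w] gives |x w|^2, and [x^(N+1)] paired with [x^2 w] has the
   real part of [q], which conjugation preserves. *)
under eq_Rintegral => x _.
  rewrite (_ : complex.Re _ =
    complex.Re q.[x%:C] + cabs ('X * w).[x%:C] ^+ 2); last first.
    rewrite /q !hornerE -rmorphXn /= cabs2E.
    case: (w.[_]) => a b /=.
    by ring.
  over.
rewrite RintegralD//; last 2 first.
- exact: integrable_Re_poly.
- exact: integrable_cabs2_poly.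
under [RHS]eq_Rintegral => x _.
  rewrite (_ : complex.Re _ = complex.Re q.[x%:C]); last first.
    by rewrite hornerC mul1r; case: (q.[_]).
  over.
move=> /eqP; rewrite -subr_eq0 addrC addKr => /eqP I0.
have Xw0 : 'X * w != 0.
  by rewrite mulf_neq0 ?polyX_eq0//; apply: contraNneq w0 => ->; rewrite horner0.
have := hpos _ Xw0.
(* [fine] sends infinity to 0, so [I0] contradicts positivity only because integrability makes the
   extended integral finite. *)
rewrite -(fineK (integrable_fin_num _ (integrable_cabs2_poly _ _ hmom _)))//.
by rewrite [fine _]I0 ltxx.
Qed.
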